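(* Let $\epsilon\in(0,1)$ and let $T^0,T^1:(-1/\epsilon,1/\epsilon)\to\mathbb{R}$ be smooth functions normalized by $$T^0(0)=T^1(0)=0,\qquad (T^0)'(0)=1,\qquad (T^1)'(0)=0.$$ Then the conservation law $$\partial_0 T^0(v)+\partial_1 T^1(v)=0,$$ whose unknown scalar field $v=v(x^0,x^1)$ takes its values in $(-1/\epsilon,1/\epsilon)$, is invariant under the Lorentz transformations (in the sense defined in the context) if and only if, for all $v\in(-1/\epsilon,1/\epsilon)$, $$T^0(v)=\frac{v}{\sqrt{1-\epsilon^2v^2}},\qquad T^1(v)=\frac{1}{\epsilon^2}\left(-1+\frac{1}{\sqrt{1-\epsilon^2v^2}}\right).$$
   Context: Here $x^0\in[0,+\infty)$, $x^1\in\mathbb{R}$, $\partial_\alpha=\partial/\partial x^\alpha$, and the parameter $\epsilon$ is the inverse of the (normalized) speed of light. The flux functions $T^0,T^1$ depend smoothly on $v$ and do not depend on $(x^0,x^1)$. For a speed $V\in(-1/\epsilon,1/\epsilon)$, put $\gamma_\epsilon(V)=(1-\epsilon^2V^2)^{-1/2}$. The Lorentz transformation with speed $V$ is $$\overline{x}^0=\gamma_\epsilon(V)\,(x^0-\epsilon^2Vx^1),\qquad \overline{x}^1=\gamma_\epsilon(V)\,(-Vx^0+x^1),$$ and the unknown $v$ is transformed into $$\overline{v}=\frac{v-V}{1-\epsilon^2Vv}.$$ In the coordinates $(\overline{x}^0,\overline{x}^1)$ the conservation law $\partial_0T^0(v)+\partial_1T^1(v)=0$ becomes $$\partial_{\overline{x}^0}\Big(\gamma_\epsilon(V)\big(T^0(v)-\epsilon^2V\,T^1(v)\big)\Big)+\partial_{\overline{x}^1}\Big(\gamma_\epsilon(V)\big(-V\,T^0(v)+T^1(v)\big)\Big)=0.$$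 Definition (invariance under the Lorentz transformations): the transformed equation has the same form as the original one, with the same flux functions evaluated at $\overline{v}$, up to additive constants. That is, for every $V\in(-1/\epsilon,1/\epsilon)$ there exist constants $C_1,C_2\in\mathbb{R}$ (possibly depending on $V$) such that, for all $v\in(-1/\epsilon,1/\epsilon)$, $$\gamma_\epsilon(V)\big(T^0(v)-\epsilon^2V\,T^1(v)\big)=T^0\Big(\frac{v-V}{1-\epsilon^2vV}\Big)+C_1,$$ $$\gamma_\epsilon(V)\big(-V\,T^0(v)+T^1(v)\big)=T^1\Big(\frac{v-V}{1-\epsilon^2vV}\Big)+C_2.$$ *)

(* Defs.v *)
From Stdlib Require Import Reals.
From Coquelicot Require Import Coquelicot.
Open Scope R_scope.

(* The open interval of admissible velocities; [eps] is the inverse of the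
   speed of light. *)
Definition admissible (eps v : R) : Prop := - (1 / eps) < v < 1 / eps.

(* A flux on (-1/eps, 1/eps) is represented by a function on all of R whose
   values outside the interval are irrelevant.  The interval being open,
   [ex_derive_n f n v] at an admissible [v] only depends on the restriction of
   [f] to the interval. *)
Definition smooth_flux (eps : R) (f : R -> R) : Prop :=
  forall (n : nat) (v : R), admissible eps v -> ex_derive_n f n v.

Definition lorentz_gamma (eps V : R) : R := / sqrt (1 - eps ^ 2 * V ^ 2).

(* The Lorentz transformation with speed [V] maps the coordinates (x0, x1) to
   (lorentz0 eps V x0 x1, lorentz1 eps V x0 x1).  By the chain rule, the
   equation d_0 T0 + d_1 T1 = 0 becomes, in the new coordinates,
   d_0 (lorentz0 eps V T0 T1) + d_1 (lorentz1 eps V T0 T1) = 0. *)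
Definition lorentz0 (eps V a0 a1 : R) : R :=
  lorentz_gamma eps V * (a0 - eps ^ 2 * V * a1).

Definition lorentz1 (eps V a0 a1 : R) : R :=
  lorentz_gamma eps V * (- V * a0 + a1).

Definition lorentz_velocity (eps V v : R) : R :=
  (v - V) / (1 - eps ^ 2 * V * v).

(* Invariance of the conservation law d_0 T0(v) + d_1 T1(v) = 0: in the new
   coordinates the fluxes are T0 and T1 evaluated at the transformed velocity,
   up to additive constants that may depend on [V] but not on [v]. *)
Definition lorentz_invariant (eps : R) (T0 T1 : R -> R) : Prop :=
  forall V : R, admissible eps V ->
  exists C1 C2 : R, forall v : R, admissible eps v ->
    lorentz0 eps V (T0 v) (T1 v) = T0 (lorentz_velocity eps V v) + C1 /\
    lorentz1 eps V (T0 v) (T1 v) = T1 (lorentz_velocity eps V v) + C2.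

(* Main.v *)
Require Import Defs.
From Stdlib Require Import Reals Lra.
From Coquelicot Require Import Coquelicot.
Open Scope R_scope.

(** Write [g] for the Lorentz factor [lorentz_gamma eps].

    Invariance determines the fluxes because the boost of speed [V] sends the
    velocity [V] to rest, where the derivatives of the fluxes are prescribed.
    Differentiating the two invariance identities at [v = V] removes the
    unknown constants, and since the boosted velocity has derivative [g V ^ 2]
    there, it leaves the linear system
      [g V * (T0' V - eps ^ 2 * V * T1' V) = g V ^ 2] and
      [g V * (- V * T0' V + T1' V) = 0],
    whose only solution is [T0' V = g V ^ 3], [T1' V = V * g V ^ 3]
    ([invariant_flux_derivatives]).  These are the derivatives of [V * g V] and
    [(g V - 1) / eps ^ 2], and fluxes vanishing at 0 are determined by their
    derivatives.

    Conversely, [(g v, v * g v)] is the two-velocity of a particle of speed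
    [v], so that it transforms linearly under boosts.  All of this is contained
    in the composition law of Lorentz factors ([lorentz_gamma_velocity]),
      [g (boosted v) = g V * g v * (1 - eps ^ 2 * V * v)],
    and the constants [C1], [C2] only compensate the normalization of [T1] at
    rest. *)

(** * Admissible velocities and Lorentz factors *)

Lemma admissible_iff (eps v : R) :
  0 < eps -> admissible eps v <-> 0 < 1 - eps ^ 2 * v ^ 2.
Proof.
  intros he; unfold admissible.
  assert (hi : eps * (1 / eps) = 1) by (field; lra).
  set (c := 1 / eps) in *; clearbody c.
  replace (1 - eps ^ 2 * v ^ 2) with ((1 - eps * v) * (1 + eps * v)) by ring.
  split.
  - intros [h1 h2]; apply Rmult_lt_0_compat; nra.
  - intros h; split; apply Rnot_le_lt; intros hv;
      apply (Rmult_le_compat_l eps) in hv; nra.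
Qed.

Lemma admissible_zero (eps : R) : 0 < eps -> admissible eps 0.
Proof. intros he; apply admissible_iff; [exact he | lra]. Qed.

(** Twice the denominator is a square plus the two positive quantities
    [1 - eps ^ 2 * V ^ 2] and [1 - eps ^ 2 * v ^ 2]. *)
Lemma lorentz_velocity_denominator_pos (eps V v : R) :
  0 < eps -> admissible eps V -> admissible eps v ->
  0 < 1 - eps ^ 2 * V * v.
Proof.
  intros he hV hv.
  apply admissible_iff in hV; [|exact he].
  apply admissible_iff in hv; [|exact he].
  pose proof (pow2_ge_0 (eps * (V - v))); nra.
Qed.

Lemma lorentz_velocity_defect (eps V v : R) :
  1 - eps ^ 2 * V * v <> 0 ->
  1 - eps ^ 2 * lorentz_velocity eps V v ^ 2 =
  (1 - eps ^ 2 * V ^ 2) * (1 - eps ^ 2 * v ^ 2) / (1 - eps ^ 2 * V * v) ^ 2.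
Proof. intros hd; unfold lorentz_velocity; field; exact hd. Qed.

Lemma lorentz_velocity_admissible (eps V v : R) :
  0 < eps -> admissible eps V -> admissible eps v ->
  admissible eps (lorentz_velocity eps V v).
Proof.
  intros he hV hv.
  pose proof (lorentz_velocity_denominator_pos eps V v he hV hv) as hd.
  apply admissible_iff; [exact he|].
  rewrite lorentz_velocity_defect by lra.
  apply Rdiv_lt_0_compat; [|apply pow_lt; exact hd].
  apply Rmult_lt_0_compat; apply admissible_iff; assumption.
Qed.

Lemma lorentz_gamma_pos (eps v : R) :
  0 < eps -> admissible eps v -> 0 < lorentz_gamma eps v.
Proof.
  intros he hv; apply Rinv_0_lt_compat, sqrt_lt_R0, admissible_iff; assumption.
Qed.

Lemma lorentz_gamma_sqr (eps v : R) :
  0 < eps -> admissible eps v ->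
  lorentz_gamma eps v ^ 2 * (1 - eps ^ 2 * v ^ 2) = 1.
Proof.
  intros he hv; unfold lorentz_gamma.
  apply admissible_iff in hv; [|exact he].
  rewrite pow_inv, pow2_sqrt by lra; field; lra.
Qed.

Lemma lorentz_gamma_velocity (eps V v : R) :
  0 < eps -> admissible eps V -> admissible eps v ->
  lorentz_gamma eps (lorentz_velocity eps V v) =
  lorentz_gamma eps V * lorentz_gamma eps v * (1 - eps ^ 2 * V * v).
Proof.
  intros he hV hv.
  pose proof (lorentz_velocity_denominator_pos eps V v he hV hv) as hd.
  unfold lorentz_gamma; rewrite lorentz_velocity_defect by lra.
  apply admissible_iff in hV; [|exact he].
  apply admissible_iff in hv; [|exact he].
  rewrite sqrt_div_alt, sqrt_mult, sqrt_pow2; try lra; [|apply pow_lt; exact hd].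
  pose proof (sqrt_lt_R0 _ hV); pose proof (sqrt_lt_R0 _ hv).
  field; lra.
Qed.

(** * The two-velocity is equivariant under boosts *)

Lemma lorentz_invariant_two_velocity (eps : R) (T0 T1 : R -> R) :
  0 < eps ->
  (forall v, admissible eps v ->
     T0 v = v * lorentz_gamma eps v /\
     T1 v = (lorentz_gamma eps v - 1) / eps ^ 2) ->
  lorentz_invariant eps T0 T1.
Proof.
  intros he hT V hV.
  (* These constants are forced: they are the values of the boosted fluxes at
     [v = V], where the boosted velocity is 0 and [T0], [T1] vanish. *)
  exists (V * lorentz_gamma eps V), ((1 - lorentz_gamma eps V) / eps ^ 2).
  intros v hv.
  pose proof (lorentz_velocity_denominator_pos eps V v he hV hv) as hd.
  destruct (hT v hv) as [-> ->].
  destruct (hT _ (lorentz_velocity_admissible eps V v he hV hv)) as [-> ->].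
  rewrite lorentz_gamma_velocity by assumption.
  unfold lorentz0, lorentz1, lorentz_velocity.
  split; field; lra.
Qed.

(** * Invariance determines the derivatives of the fluxes *)

Lemma lorentz_velocity_self (eps V : R) : lorentz_velocity eps V V = 0.
Proof. unfold lorentz_velocity, Rdiv; ring. Qed.

Lemma is_derive_lorentz_velocity_self (eps V : R) :
  0 < eps -> admissible eps V ->
  is_derive (lorentz_velocity eps V) V (lorentz_gamma eps V ^ 2).
Proof.
  intros he hV.
  pose proof (lorentz_gamma_sqr eps V he hV) as hg.
  apply admissible_iff in hV; [|exact he].
  replace (lorentz_gamma eps V ^ 2) with (/ (1 - eps ^ 2 * V ^ 2))
    by (apply Rmult_eq_reg_r with (1 - eps ^ 2 * V ^ 2);
        [rewrite hg; field|]; lra).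
  unfold lorentz_velocity; auto_derive; [|field]; lra.
Qed.

Lemma locally_admissible (eps v : R) :
  admissible eps v -> locally v (admissible eps).
Proof.
  intros [h1 h2].
  exact (filter_and _ _ (open_gt _ v h1) (open_lt _ v h2)).
Qed.

(** An additive constant disappears under differentiation, and at [v = V] the
    chain rule only involves the derivative of the flux at rest. *)
Lemma boosted_flux_derivative (eps V C d l : R) (F T : R -> R) :
  0 < eps -> admissible eps V ->
  (forall v, admissible eps v -> F v = T (lorentz_velocity eps V v) + C) ->
  is_derive T 0 d -> is_derive F V l ->
  l = lorentz_gamma eps V ^ 2 * d.
Proof.
  intros he hV hF hT hl.
  rewrite <- (is_derive_unique _ _ _ hl).
  apply is_derive_unique.
  apply is_derive_ext_loc with (fun v => T (lorentz_velocity eps V v) + C).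
  - apply filter_imp with (2 := locally_admissible eps V hV).
    intros v hv; symmetry; exact (hF v hv).
  - rewrite <- (Rplus_0_r (_ * d)).
    apply (is_derive_plus (fun v => T (lorentz_velocity eps V v)) (fun _ => C)).
    + apply (is_derive_comp T (lorentz_velocity eps V));
        [|apply is_derive_lorentz_velocity_self; assumption].
      rewrite lorentz_velocity_self; exact hT.
    + exact (is_derive_const (K := R_AbsRing) (V := R_NormedModule) C V).
Qed.

Lemma invariant_flux_derivatives (eps : R) (T0 T1 : R -> R) :
  0 < eps ->
  (forall v, admissible eps v -> ex_derive T0 v /\ ex_derive T1 v) ->
  is_derive T0 0 1 -> is_derive T1 0 0 ->
  lorentz_invariant eps T0 T1 ->
  forall v, admissible eps v ->
    is_derive T0 v (lorentz_gamma eps v ^ 3) /\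
    is_derive T1 v (v * lorentz_gamma eps v ^ 3).
Proof.
  intros he hT h0 h1 hinv V hV.
  destruct (hT V hV) as [[a ha] [b hb]].
  destruct (hinv V hV) as [C1 [C2 hC]].
  assert (e0 : lorentz_gamma eps V * (a - eps ^ 2 * V * b) =
               lorentz_gamma eps V ^ 2 * 1).
  { apply boosted_flux_derivative
      with (C := C1) (T := T0) (F := fun v => lorentz0 eps V (T0 v) (T1 v));
      try assumption.
    - intros v hv; apply hC; exact hv.
    - apply is_derive_scal.
      apply (is_derive_minus T0 (fun v => eps ^ 2 * V * T1 v)); [exact ha|].
      apply is_derive_scal; exact hb. }
  assert (e1 : lorentz_gamma eps V * (- V * a + b) =
               lorentz_gamma eps V ^ 2 * 0).
  { apply boosted_flux_derivative
      with (C := C2) (T := T1) (F := fun v => lorentz1 eps V (T0 v) (T1 v));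
      try assumption.
    - intros v hv; apply hC; exact hv.
    - apply is_derive_scal.
      apply (is_derive_plus (fun v => - V * T0 v) T1); [|exact hb].
      apply is_derive_scal; exact ha. }
  pose proof (lorentz_gamma_pos eps V he hV) as hg.
  pose proof (lorentz_gamma_sqr eps V he hV) as hg2.
  set (g := lorentz_gamma eps V) in *.
  assert (eb : b = V * a :> R).
  { apply Rmult_eq_reg_l with g; [|lra]; lra. }
  assert (ea : a * (1 - eps ^ 2 * V ^ 2) = g).
  { apply Rmult_eq_reg_l with g; [|lra]; rewrite eb in e0; lra. }
  assert (ea' : a = g ^ 3 :> R).
  { rewrite <- (Rmult_1_r a), <- hg2.
    transitivity (g ^ 2 * (a * (1 - eps ^ 2 * V ^ 2))); [|rewrite ea]; ring. }
  rewrite <- ea', <- eb; split; assumption.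
Qed.

(** * Integrating the derivatives *)

Lemma is_derive_lorentz_gamma (eps v : R) :
  0 < eps -> admissible eps v ->
  is_derive (lorentz_gamma eps) v (eps ^ 2 * v * lorentz_gamma eps v ^ 3).
Proof.
  intros he hv.
  apply admissible_iff in hv; [|exact he].
  pose proof (sqrt_lt_R0 _ hv) as hs.
  unfold lorentz_gamma; auto_derive.
  - replace (1 + - _) with (1 - eps ^ 2 * v ^ 2) by ring; repeat split; lra.
  - replace (1 + - _) with (1 - eps ^ 2 * v ^ 2) by ring; field; lra.
Qed.

Lemma is_derive_two_velocity_space (eps v : R) :
  0 < eps -> admissible eps v ->
  is_derive (fun u => u * lorentz_gamma eps u) v (lorentz_gamma eps v ^ 3).
Proof.
  intros he hv.
  (* Leibniz gives [g + v * (eps ^ 2 * v * g ^ 3)], and [g] itself is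
     [g ^ 3 * (1 - eps ^ 2 * v ^ 2)]. *)
  replace (lorentz_gamma eps v ^ 3)
    with (1 * lorentz_gamma eps v +
          v * (eps ^ 2 * v * lorentz_gamma eps v ^ 3)).
  - apply (is_derive_mult (fun u => u) (lorentz_gamma eps)).
    + exact (is_derive_id v).
    + apply is_derive_lorentz_gamma; assumption.
    + intros; apply Rmult_comm.
  - transitivity (lorentz_gamma eps v *
        (lorentz_gamma eps v ^ 2 * (1 - eps ^ 2 * v ^ 2)) +
        v * (eps ^ 2 * v * lorentz_gamma eps v ^ 3)).
    + rewrite lorentz_gamma_sqr by assumption; ring.
    + ring.
Qed.

Lemma is_derive_two_velocity_time (eps v : R) :
  0 < eps -> admissible eps v ->
  is_derive (fun u => (lorentz_gamma eps u - 1) / eps ^ 2) v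
    (v * lorentz_gamma eps v ^ 3).
Proof.
  intros he hv.
  pose proof (is_derive_lorentz_gamma eps v he hv) as hg.
  auto_derive.
  - exact (ex_intro _ _ hg).
  - change (Derive (fun u : R => lorentz_gamma eps u) v)
      with (Derive (lorentz_gamma eps) v).
    rewrite (is_derive_unique _ _ _ hg); field; lra.
Qed.

Lemma equal_derivatives_admissible (eps : R) (f g h : R -> R) :
  0 < eps -> f 0 = g 0 ->
  (forall v, admissible eps v -> is_derive f v (h v)) ->
  (forall v, admissible eps v -> is_derive g v (h v)) ->
  forall v, admissible eps v -> f v = g v.
Proof.
  intros he h0 hf hg v hv.
  assert (hd : forall u, Rmin 0 v <= u <= Rmax 0 v ->
                 is_derive (fun u => f u - g u) u 0).
  { intros u hu.
    assert (ha : admissible eps u).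
    { pose proof (admissible_zero eps he) as hz.
      unfold admissible, Rmin, Rmax in *; destruct (Rle_dec 0 v); lra. }
    rewrite <- (Rminus_diag (h u)).
    apply (is_derive_minus f g); [apply hf | apply hg]; exact ha. }
  destruct (MVT_gen (fun u => f u - g u) 0 v (fun _ => 0)) as [c [_ hc]].
  - intros u hu; apply hd; lra.
  - intros u hu; apply continuity_pt_filterlim.
    apply (ex_derive_continuous (fun u => f u - g u)).
    exists 0; apply hd; exact hu.
  - lra.
Qed.

Lemma lorentz_gamma_zero (eps : R) : lorentz_gamma eps 0 = 1.
Proof.
  unfold lorentz_gamma.
  replace (1 - eps ^ 2 * 0 ^ 2) with 1 by ring.
  rewrite sqrt_1; field.
Qed.

(** * Characterization of the invariant conservation law *)

Theorem theorem2p1 (eps : R) (heps : 0 < eps < 1) (T0 T1 : R -> R)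
    (hT0 : smooth_flux eps T0) (hT1 : smooth_flux eps T1)
    (hT0_0 : T0 0 = 0) (hT1_0 : T1 0 = 0)
    (hdT0_0 : is_derive T0 0 1) (hdT1_0 : is_derive T1 0 0) :
  lorentz_invariant eps T0 T1 <->
  (forall v : R, admissible eps v ->
     T0 v = v / sqrt (1 - eps ^ 2 * v ^ 2) /\
     T1 v = 1 / eps ^ 2 * (-1 + 1 / sqrt (1 - eps ^ 2 * v ^ 2))).
Proof.
  assert (he : 0 < eps) by lra.
  assert (hform : forall v, 1 / eps ^ 2 * (-1 + 1 / sqrt (1 - eps ^ 2 * v ^ 2))
                            = (lorentz_gamma eps v - 1) / eps ^ 2).
  { intros v; unfold lorentz_gamma, Rdiv; ring. }
  split.
  - intros hinv.
    assert (hd := invariant_flux_derivatives eps T0 T1 he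
      (fun v hv => conj (hT0 1%nat v hv) (hT1 1%nat v hv)) hdT0_0 hdT1_0 hinv).
    intros v hv; rewrite hform; split.
    + apply (equal_derivatives_admissible eps T0
        (fun u => u * lorentz_gamma eps u) (fun u => lorentz_gamma eps u ^ 3));
        try assumption.
      * rewrite hT0_0; ring.
      * intros u hu; apply hd; exact hu.
      * intros u hu; apply is_derive_two_velocity_space; assumption.
    + apply (equal_derivatives_admissible eps T1
        (fun u => (lorentz_gamma eps u - 1) / eps ^ 2)
        (fun u => u * lorentz_gamma eps u ^ 3)); try assumption.
      * rewrite hT1_0, lorentz_gamma_zero; field; lra.
      * intros u hu; apply hd; exact hu.
      * intros u hu; apply is_derive_two_velocity_time; assumption.
  - intros hT; apply lorentz_invariant_two_velocity; [exact he|].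
    intros v hv; rewrite <- hform; exact (hT v hv).
Qed.
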